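(* Let $\mathbf E=(E,+,{}',0,1)$ be an effect algebra. Then $E$ is a deductive system of $\mathbf E$. Moreover, a proper subset $D$ of $E$ containing $1$ is a deductive system of $\mathbf E$ if and only if $D\cap D'=\emptyset$.
   Context: An effect algebra is a partial algebra $(E,+,{}',0,1)$ of type $(2,1,0,0)$ where $+$ is a partial binary operation such that for all $x,y,z\in E$: (E1) $x+y$ is defined iff $y+x$ is defined, and then $x+y=y+x$; (E2) $(x+y)+z$ is defined iff $x+(y+z)$ is defined, and then they are equal; (E3) $x'$ is the unique $u\in E$ with $x+u=1$; (E4) if $1+x$ is defined then $x=0$. The induced order is $x\leq y$ iff $x+z=y$ for some $z$; $x+y$ is defined iff $x\leq y'$. $L(x,y)$ is the set of common lower bounds of $x,y$, and the implication is the subset $x\rightarrow y:=x'+L(x,y)=\{x'+u\mid u\in L(x,y)\}$. For $D\subseteq E$, $D'=\{d'\mid d\in D\}$. A subset $D\subseteq E$ is a deductive system of $\mathbf E$ if $1\in D$ and, for all $x,y\in E$, $x\in D$ and $x\rightarrow y\subseteq D$ imply $y\in D$. *)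

(* Defs.v *)
From mathcomp Require Import all_boot.
From mathcomp Require Import boolp classical_sets.

Set Implicit Arguments.
Unset Strict Implicit.
Unset Printing Implicit Defensive.

Local Open Scope classical_set_scope.

(* The partial operation is option-valued: [ea_add x y = None] means that
   x + y is undefined.  Hence an equation between values of [ea_add] says both
   that the two sides are defined simultaneously and that they then agree; in
   [ea_addA], [obind] makes an iterated sum undefined as soon as its inner sum
   is undefined. *)
Record effectAlgebra := EffectAlgebra {
  ea_carrier :> Type;
  ea_add : ea_carrier -> ea_carrier -> option ea_carrier;
  ea_compl : ea_carrier -> ea_carrier;
  ea_zero : ea_carrier;
  ea_one : ea_carrier;
  ea_addC : forall x y, ea_add x y = ea_add y x;
  ea_addA : forall x y z,
    obind (fun s => ea_add s z) (ea_add x y) =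
    obind (fun s => ea_add x s) (ea_add y z);
  ea_complP : forall x u, ea_add x u = Some ea_one <-> u = ea_compl x;
  ea_add1 : forall x, ea_add ea_one x <> None -> x = ea_zero
}.

Arguments ea_zero {e}.
Arguments ea_one {e}.

Definition ea_le (E : effectAlgebra) (x y : E) : Prop :=
  exists z, ea_add x z = Some y.

Definition ea_lbounds (E : effectAlgebra) (x y : E) : set E :=
  [set u | ea_le u x /\ ea_le u y].

(* Every sum x' + u below is defined, because u <= x: see [ea_add_compl_def]. *)
Definition ea_impl (E : effectAlgebra) (x y : E) : set E :=
  [set w | exists2 u, ea_lbounds x y u & ea_add (ea_compl x) u = Some w].

Definition ea_compl_set (E : effectAlgebra) (D : set E) : set E :=
  [set ea_compl d | d in D].

Definition deductive_system (E : effectAlgebra) (D : set E) : Prop :=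
  D ea_one /\ forall x y : E, D x -> ea_impl x y `<=` D -> D y.

Lemma ea_add_compl_def (E : effectAlgebra) (x u : E) :
  ea_le u x -> ea_add (ea_compl x) u <> None.
Proof.
case=> z uz; have := ea_addA z u (ea_compl x).
rewrite (ea_addC z u) uz /= (proj2 (ea_complP x _) erefl) (ea_addC u).
by case: (ea_add (ea_compl x) u).
Qed.

(* Main.v *)
Require Import Defs.
From mathcomp Require Import all_boot.
From mathcomp Require Import boolp classical_sets.

Local Open Scope classical_set_scope.

(* Since 0 is a common lower bound of x and y, x' always lies in x -> y.  So if
   x in D and x -> y is included in D, then x' lies in both D and D'.
   Conversely x -> 0 = {x'} and 0 -> y = {1}: if D is a deductive system
   containing x and x', it contains 0 and hence every y. *)

Lemma ea_add_compl (E : effectAlgebra) (x : E) :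
  ea_add x (ea_compl x) = Some ea_one.
Proof. exact/ea_complP. Qed.

Lemma ea_complK (E : effectAlgebra) (x : E) : ea_compl (ea_compl x) = x.
Proof. by apply/esym/ea_complP; rewrite ea_addC ea_add_compl. Qed.

Lemma ea_compl1 (E : effectAlgebra) : ea_compl ea_one = ea_zero :> E.
Proof. by apply: ea_add1; rewrite ea_add_compl. Qed.

Lemma ea_compl0 (E : effectAlgebra) : ea_compl ea_zero = ea_one :> E.
Proof. by rewrite -ea_compl1 ea_complK. Qed.

(** Associativity on x', x, 0 gives x' + (x + 0) = 1 + 0 = 1, as 0 = 1'; uniqueness of complements
    then makes x + 0 equal to x''. *)
Lemma ea_addx0 (E : effectAlgebra) (x : E) : ea_add x ea_zero = Some x.
Proof.
have := ea_addA (ea_compl x) x ea_zero.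
rewrite (ea_addC _ x) ea_add_compl /= -ea_compl1 ea_add_compl.
case: (ea_add x _) => //= s /esym /ea_complP ->.
by rewrite ea_complK.
Qed.

Lemma ea_le0x (E : effectAlgebra) (x : E) : ea_le ea_zero x.
Proof. by exists x; rewrite ea_addC ea_addx0. Qed.

(** If x + z = 0, then 1 + (x + z) is defined, hence so is 1 + x, and (E4) applies. *)
Lemma ea_lex0 (E : effectAlgebra) (x : E) : ea_le x ea_zero -> x = ea_zero.
Proof.
case=> z xz; apply: ea_add1 => ox.
by have := ea_addA ea_one x z; rewrite ox xz /= ea_addx0.
Qed.

Lemma compl_in_ea_impl (E : effectAlgebra) (x y : E) :
  ea_impl x y (ea_compl x).
Proof.
by exists ea_zero; [split; exact: ea_le0x | exact: ea_addx0].
Qed.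

Lemma ea_implx0 (E : effectAlgebra) (x : E) :
  ea_impl x ea_zero = [set ea_compl x].
Proof.
apply/seteqP; split=> [w [u [_ /ea_lex0 ->]]|_ ->].
- by rewrite ea_addx0 => -[->].
- exact: compl_in_ea_impl.
Qed.

Lemma ea_impl0x (E : effectAlgebra) (y : E) : ea_impl ea_zero y = [set ea_one].
Proof.
apply/seteqP; split=> [w [u [/ea_lex0 -> _]]|_ ->].
- by rewrite ea_addx0 ea_compl0 => -[->].
- by rewrite -ea_compl0; exact: compl_in_ea_impl.
Qed.

Theorem theorem12 (E : effectAlgebra) :
  deductive_system [set: E] /\
  (forall D : set E, D `<` [set: E] -> D ea_one ->
    (deductive_system D <-> D `&` ea_compl_set D = set0)).
Proof.
split=> [|D [_ Dproper] D1]; first by [].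
split=> [[_ mp]|DD'0].
- apply/seteqP; split=> // z [Dz [x Dx x'z]].
  have D0 : D ea_zero by apply: (mp x) => //; rewrite ea_implx0 x'z => _ ->.
  (* Properness is refuted by showing that D contains an arbitrary y. *)
  apply: Dproper => y _.
  by apply: (mp ea_zero) => //; rewrite ea_impl0x => _ ->.
(* The closure condition holds vacuously: its two premises never hold together when D and D' are
   disjoint. *)
- split=> // x y Dx xyD; exfalso.
  suff : (D `&` ea_compl_set D) (ea_compl x) by rewrite DD'0.
  by split; [apply/xyD/compl_in_ea_impl | exists x].
Qed.
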